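(* (a) Let $n>1$ be an integer. There is a multiplicative $n$-satisfactory coloring of $K_n$ if and only if the set of multiplicative $n$-satisfactory colorings of $\mathbb Z^+$ has cardinality $\mathfrak c=|\mathbb R|$. (b) For any positive integer $n$, there are only finitely many multiplicative $n$-satisfactory colorings of $K_n$.
   Context: $[n]=\{1,\dots,n\}$. $K_n$ is the set of positive integers all of whose prime factors are less than or equal to $n$. For $X=\mathbb Z^+$ or $X=K_n$, an $n$-satisfactory coloring of $X$ is a map $c:X\to[n]$ with $c(i)=i$ for all $i\in[n]$ and such that for every $a\in X$ the colors $c(a),c(2a),\dots,c(na)$ are all different. Such a $c$ is multiplicative if there is an abelian group structure $([n],\oplus)$ on the set $[n]$ such that $c(ab)=c(a)\oplus c(b)$ for all $a,b\in X$. *)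

(* Defs.v *)
From mathcomp Require Import all_boot.
From mathcomp Require Import all_classical all_reals.

Set Implicit Arguments.
Unset Strict Implicit.
Unset Printing Implicit Defensive.

Local Open Scope classical_set_scope.

(* [n] = {1, ..., n}; ordinals start at 0, whence the bound n.+1. *)
Definition color (n : nat) := {i : 'I_n.+1 | 0 < i}.

(* A multiplicatively closed set of natural numbers containing [n]: this is what
   makes c(i) for i in [n], c(i a) and c(a b) meaningful for c defined on it. *)
Record dom (n : nat) := Dom {
  dom_pred : pred nat;
  dom_color : forall k : color n, dom_pred (val (val k));
  dom_mul : forall a b, dom_pred a -> dom_pred b -> dom_pred (a * b) }.

Definition elt (n : nat) (X : dom n) := {m : nat | dom_pred X m}.

Definition of_color (n : nat) (X : dom n) (k : color n) : elt X :=
  exist _ (val (val k)) (dom_color X k).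

Definition mul (n : nat) (X : dom n) (a b : elt X) : elt X :=
  exist _ (val a * val b) (dom_mul (valP a) (valP b)).

Definition Zpos_pred : pred nat := fun m => 0 < m.

Lemma Zpos_color (n : nat) (k : color n) : Zpos_pred (val (val k)).
Proof. exact: valP k. Qed.

Lemma Zpos_mul (a b : nat) : Zpos_pred a -> Zpos_pred b -> Zpos_pred (a * b).
Proof. by rewrite /Zpos_pred muln_gt0 => -> ->. Qed.

Definition Zpos (n : nat) : dom n := Dom (@Zpos_color n) Zpos_mul.

Definition K_pred (n : nat) : pred nat := fun m => [pred p | p <= n].-nat m.

Lemma K_color (n : nat) (k : color n) : K_pred n (val (val k)).
Proof.
have k_gt0 : 0 < val (val k) by exact: valP k.
apply/pnatP => // p _ /(dvdn_leq k_gt0) le_pk.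
by rewrite inE (leq_trans le_pk) // -ltnS ltn_ord.
Qed.

Lemma K_mul (n a b : nat) : K_pred n a -> K_pred n b -> K_pred n (a * b).
Proof. by rewrite /K_pred pnatM => -> ->. Qed.

Definition K (n : nat) : dom n := Dom (@K_color n) (@K_mul n).

Definition satisfactory (n : nat) (X : dom n) (c : elt X -> color n) : Prop :=
  (forall i : color n, c (of_color X i) = i) /\
  (forall a : elt X, injective (fun i : color n => c (mul (of_color X i) a))).

Definition abelian_group_law (T : Type) (op : T -> T -> T) : Prop :=
  [/\ associative op, commutative op &
      exists (e : T) (inv : T -> T), left_id e op /\ left_inverse e inv op].

Definition multiplicative (n : nat) (X : dom n) (c : elt X -> color n) : Prop :=
  exists op : color n -> color n -> color n,
    abelian_group_law op /\ forall a b : elt X, c (mul a b) = op (c a) (c b).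

Definition mult_satisfactory (n : nat) (X : dom n) : set (elt X -> color n) :=
  [set c | satisfactory c /\ multiplicative c].

Arguments mult_satisfactory {n} X _.

(* Main.v *)
Require Import Defs.
From mathcomp Require Import all_boot.
From mathcomp Require Import all_classical all_reals.
From mathcomp Require Import order ssralg ssrnum rat interval lra.

Set Implicit Arguments.
Unset Strict Implicit.
Unset Printing Implicit Defensive.

Local Open Scope classical_set_scope.

(** A multiplicative satisfactory coloring of [K n] extends to the positive
    integers with complete freedom on the primes above [n]: replacing each such
    prime by an arbitrary element of [K n] defines a multiplicative retraction of
    the positive integers onto [K n], with which the coloring is composed. The
    colors of [a], [2 a], ..., [n a] are then those of the multiples of the image
    of [a], hence still distinct. As [1 < n], the two replacements 1 and 2 are available at each of the infinitely many primes above [n] and get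
    distinct colors, so each sequence of bits gives its own coloring of the
    positive integers ([card_le_mult_satisfactory]). There are at most as many
    colorings as bit sequences, since a map between countable types is coded by
    the indicator of its graph ([card_le_fun_bool]), and there are as many bit
    sequences as real numbers ([card_bool_real]), so Cantor-Bernstein gives
    cardinality exactly the continuum. Conversely, a set in bijection with the
    reals has an element, and restricting that coloring to [K n] preserves the
    group law.

    Finiteness holds because a multiplicative coloring of [K n] is determined by
    its group law: elements of [K n] are products of primes at most [n], whose
    colors are prescribed ([mult_coloring_unique]). A finite set carries finitely
    many binary operations. *)

(** * The cardinality of the continuum *)

Lemma inj_card_leT (T U : Type) (A : set T) (f : T -> U) :
  injective f -> (A #<= [set: U])%card.
Proof.
move=> f_inj; apply: (@card_le_trans _ _ _ (f @` A)); last exact: card_leT.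
have := @inj_card_eq _ _ A f (in2W f_inj).
by rewrite card_eq_sym card_eq_le => /andP[].
Qed.

(** A function between countable types is coded by the indicator of its graph. *)
Lemma card_le_fun_bool (T U : countType) (A : set (T -> U)) :
  (A #<= [set: nat -> bool])%card.
Proof.
pose code (f : T -> U) (k : nat) :=
  if unpickle k is Some (x, y) then f x == y else false.
apply: (@inj_card_leT _ _ _ code) => f g fg; apply/funext => x.
have := congr1 (fun h => h (pickle (x, f x))) fg.
by rewrite /code pickleK eqxx => /esym/eqP.
Qed.

Section Continuum.
Import Order.TTheory GRing.Theory Num.Theory.
Local Open Scope ring_scope.
Variable R : realType.

(** A real number is determined by the set of rationals below it, and the
    rationals are countable. *)
Lemma card_le_real_bool : ([set: R] #<= [set: nat -> bool])%card.
Proof.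
pose cut (x : R) (q : rat) := ratr q < x.
apply: (@card_le_trans _ _ _ [set: rat -> bool]); last first.
  exact: card_le_fun_bool.
apply: (@inj_card_leT _ _ _ cut) => x y.
wlog le_xy : x y / x <= y => [th|] xy.
  by case: (leP x y) => [|/ltW] le; [|apply/esym]; apply: th.
apply/eqP; move: le_xy; rewrite le_eqVlt => /predU1P[-> //|lt_xy].
have [q] := rat_in_itvoo lt_xy; rewrite in_itv /= => /andP[xq qy].
have := congr1 (fun h => h q) xy.
by rewrite /cut qy ltNge (ltW xq).
Qed.

Definition ternary_sum (b : nat -> bool) (n : nat) : R :=
  \sum_(k < n) (b k)%:R * 3^-1 ^+ k.

Lemma ternary_sumS b n :
  ternary_sum b n.+1 = ternary_sum b n + (b n)%:R * 3^-1 ^+ n.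
Proof. by rewrite /ternary_sum big_ord_recr. Qed.

Let pow3_gt0 n : 0 < 3^-1 ^+ n :> R.
Proof. by rewrite exprn_gt0 // invr_gt0. Qed.

(** The tail of the series after the first [m] digits is at most
    [\sum_(k >= m) 3^-k = 3/2 * 3^-m]. Adding this bound makes the partial sums
    nonincreasing, while without it they are nondecreasing. *)
Lemma ternary_sum_le b m n :
  ternary_sum b n <= ternary_sum b m + 3 / 2 * 3^-1 ^+ m.
Proof.
have up i j : ternary_sum b i <= ternary_sum b (i + j).
  elim: j => [|j ih]; first by rewrite addn0.
  rewrite addnS ternary_sumS (le_trans ih) // lerDl mulr_ge0 ?ler0n //.
  exact/ltW/pow3_gt0.
have down i j : ternary_sum b (i + j) + 3 / 2 * 3^-1 ^+ (i + j)
    <= ternary_sum b i + 3 / 2 * 3^-1 ^+ i.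
  elim: j => [|j ih]; first by rewrite addn0.
  apply: le_trans ih; rewrite addnS ternary_sumS exprS.
  by have := pow3_gt0 (i + j); case: (b _) => /=; lra.
case: (leqP m n) => [/subnKC <-|/ltnW/subnKC <-].
  apply: (le_trans _ (down m (n - m)%N)); rewrite lerDl.
  by rewrite mulr_ge0 ?divr_ge0 // ltW // pow3_gt0.
apply: (le_trans (up n (m - n)%N)); rewrite lerDl.
by rewrite mulr_ge0 ?divr_ge0 // ltW // pow3_gt0.
Qed.

(** The supremum of the partial sums stands for the sum of the series, so that
    completeness of the order suffices and no limit is involved. *)
Definition ternary (b : nat -> bool) : R := sup (range (ternary_sum b)).

Lemma ternary_ge b n : ternary_sum b n <= ternary b.
Proof.
apply: ub_le_sup; last by exists n.
exists (ternary_sum b 0 + 3 / 2 * 3^-1 ^+ 0) => _ [m _ <-].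
exact: ternary_sum_le.
Qed.

Lemma ternary_le b m : ternary b <= ternary_sum b m + 3 / 2 * 3^-1 ^+ m.
Proof.
apply: ge_sup; first by exists (ternary_sum b 0), 0%N.
by move=> _ [n _ <-]; exact: ternary_sum_le.
Qed.

(** The digits 0 and 1 only are used in base 3, so that at the first digit where
    two sequences differ the gap exceeds what all later digits can make up. *)
Lemma ternary_inj : injective ternary.
Proof.
move=> b b' bb'; apply/funext => n.
elim/ltn_ind: n => n ih.
have eqn : ternary_sum b n = ternary_sum b' n.
  by apply: eq_bigr => k _; rewrite ih.
have := (ternary_ge b n.+1, ternary_ge b' n.+1, ternary_le b n.+1,
         ternary_le b' n.+1).
rewrite bb' !ternary_sumS eqn exprS.
have := pow3_gt0 n.
by case: (b n); case: (b' n) => //= gt0 [[[]]]; lra.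
Qed.

Lemma card_bool_real : ([set: nat -> bool] #= [set: R])%card.
Proof.
by rewrite card_eq_le card_le_real_bool (inj_card_leT _ ternary_inj).
Qed.

End Continuum.

(** * Completely multiplicative maps *)

(** The completely multiplicative map with value [g p] at each prime [p]: factors
    at non-primes vanish because [logn] is 0 there. *)
Definition replace_primes (g : nat -> nat) (m : nat) : nat :=
  \prod_(0 <= p < m.+1) g p ^ logn p m.

Section ReplacePrimes.
Variable g : nat -> nat.

(** A common range of primes lets the products for different arguments be
    compared factor by factor; the added factors have exponent 0. *)
Lemma replace_primes_widen m N : m <= N ->
  replace_primes g m = \prod_(0 <= p < N.+1) g p ^ logn p m.
Proof.
move=> le_mN; rewrite (big_cat_nat (n := m.+1)) //=.
rewrite [X in _ * X]big1_seq ?muln1 //.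
move=> p /=; rewrite mem_index_iota => /andP[lt_mp _].
by rewrite ltn_log0.
Qed.

Lemma replace_primesM a b : 0 < a -> 0 < b ->
  replace_primes g (a * b) = replace_primes g a * replace_primes g b.
Proof.
move=> a_gt0 b_gt0.
rewrite (replace_primes_widen (N := a * b) (m := a)) ?leq_pmulr //.
rewrite (replace_primes_widen (N := a * b) (m := b)) ?leq_pmull //.
rewrite -big_split /=; apply: eq_bigr => p _.
by rewrite lognM // expnD.
Qed.

Lemma replace_primes_prime p : prime p -> replace_primes g p = g p.
Proof.
move=> p_prime; rewrite /replace_primes big_nat_recr //= logn_prime // eqxx expn1.
rewrite big1_seq ?mul1n // => q /=; rewrite mem_index_iota => /andP[_ lt_qp].
by rewrite logn_prime // ltn_eqF.
Qed.

Lemma replace_primes_id m : 0 < m ->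
  (forall p, prime p -> p %| m -> g p = p) -> replace_primes g m = m.
Proof.
move=> m_gt0 gE; rewrite -[RHS](partnT m_gt0); apply: eq_bigr => p _.
rewrite lognE; case: ifP => // /and3P[p_prime _ p_dvd].
by rewrite gE.
Qed.

Lemma replace_primes_K n m :
  (forall p, prime p -> K_pred n (g p)) -> K_pred n (replace_primes g m).
Proof.
move=> gK; apply: (big_ind (K_pred n)) => // [a b|p _]; first exact: K_mul.
case: (boolP (prime p)) => [p_prime|/negPf np]; last by rewrite lognE np.
by rewrite /K_pred pnatX [_.-nat (g p)]gK.
Qed.

End ReplacePrimes.

(** * Transporting colorings along multiplicative maps *)

(** A multiplicative map that fixes the numbers 1, ..., [n] turns [i * a] into
    [i * h a], so both the distinctness of their colors and the group law pull
    back along it. It yields both the restriction to [K n] and the extensions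
    from [K n]. *)
Lemma mult_satisfactory_comp n (X Y : dom n) (h : elt X -> elt Y)
    (c : elt Y -> color n) :
  (forall i, h (of_color X i) = of_color Y i) ->
  (forall a b, h (Defs.mul a b) = Defs.mul (h a) (h b)) ->
  mult_satisfactory Y c -> mult_satisfactory X (c \o h).
Proof.
move=> hcol hmul [[c_col c_inj] [op [op_law c_op]]]; split; last first.
  by exists op; split=> // a b /=; rewrite hmul c_op.
split=> [i|a i j] /=; first by rewrite hcol c_col.
by rewrite !hmul !hcol; exact: c_inj.
Qed.

Lemma K_pred_gt0 n m : K_pred n m -> 0 < m.
Proof. by case/andP. Qed.

Definition K_Zpos n (x : elt (K n)) : elt (Zpos n) :=
  exist _ (val x) (K_pred_gt0 (valP x)).

Lemma restrict_mult_satisfactory n (c : elt (Zpos n) -> color n) :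
  mult_satisfactory (Zpos n) c -> mult_satisfactory (K n) (c \o @K_Zpos n).
Proof. by apply: mult_satisfactory_comp => [i|a b]; apply: val_inj. Qed.

Lemma infinite_primes_gt n :
  exists q : nat -> nat, injective q /\ forall k, prime (q k) /\ n < q k.
Proof.
pose next m := s2val (prime_above m).
have next_gt m : m < next m by rewrite /next; case: (prime_above m).
have next_prime m : prime (next m) by rewrite /next; case: (prime_above m).
pose q k := iter k.+1 next n.
have q_incr : {homo q : i j / i < j}.
  by apply: homo_ltn; [exact: ltn_trans | move=> k; exact: next_gt].
exists q; split=> [|k].
  exact/incn_inj/leq_mono.
split; first exact: next_prime.
by elim: k => [|k ih]; [exact: next_gt | exact: ltn_trans ih (next_gt _)].
Qed.

(** Bit [k] of a sequence decides whether the [k]-th chosen prime above [n] is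
    replaced by 1 or by 2, and is read back from the color of that prime. *)
Lemma card_le_mult_satisfactory n (c : elt (K n) -> color n) :
  1 < n -> mult_satisfactory (K n) c ->
  ([set: nat -> bool] #<= mult_satisfactory (Zpos n))%card.
Proof.
move=> n_gt1 c_ms.
have [q [q_inj q_prop]] := infinite_primes_gt n.
pose g (b : nat -> bool) p :=
  if p <= n then p else if `[< exists2 k, q k = p & b k >] then 2 else 1.
have gq b k : g b (q k) = (b k).+1.
  rewrite /g leqNgt (q_prop k).2 /=; case: asboolP => [[j /q_inj -> ->] //|no].
  by case: (boolP (b k)) => // bk; case: no; exists k.
have gK b p : prime p -> K_pred n (g b p).
  move=> p_prime; rewrite /g; case: ifP => [le_pn|_].
    by rewrite /K_pred pnatE.
  by case: ifP => // _; rewrite /K_pred pnatE.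
pose h b (x : elt (Zpos n)) : elt (K n) :=
  exist _ (replace_primes (g b) (val x)) (replace_primes_K _ (gK b)).
have h_ms b : mult_satisfactory (Zpos n) (c \o h b).
  apply: mult_satisfactory_comp c_ms => [i|x y]; apply: val_inj => /=; last first.
    exact: replace_primesM (valP x) (valP y).
  apply: replace_primes_id => [|p _ p_dvd]; first exact: (valP i).
  rewrite /g ifT // (leq_trans (dvdn_leq (valP i) p_dvd)) //.
  by rewrite -ltnS ltn_ord.
have ch_inj : injective (fun b => c \o h b).
  move=> b b' bb'; apply/funext => k.
  pose x : elt (Zpos n) := exist _ (q k) (prime_gt0 (q_prop k).1).
  have col_lt (d : bool) : d.+1 < n.+1 by case: d; rewrite ?ltnS // ltnW.
  (* The color [d + 1], which exists since [1 < n]. *)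
  pose col (d : bool) : color n :=
    exist (fun i : 'I_n.+1 => 0 < i) (Ordinal (col_lt d)) isT.
  have ch_col a : (c \o h a) x = col (a k).
    have -> : (c \o h a) x = c (of_color (K n) (col (a k))).
      congr (c _); apply: val_inj; rewrite /= replace_primes_prime ?gq //.
      exact: (q_prop k).1.
    exact: c_ms.1.1.
  have := ch_col b; rewrite bb' ch_col => /(congr1 (fun i => val (val i))) /=.
  by case: (b k); case: (b' k).
apply: (@card_le_trans _ _ _ (range (fun b => c \o h b))).
  have := @inj_card_eq _ _ setT _ (in2W ch_inj).
  by rewrite card_eq_sym card_eq_le => /andP[].
by apply: subset_card_le => _ [b _ <-]; exact: h_ms.
Qed.

(** * Colorings of the smooth numbers *)

(** Every element of [K n] is a product of primes at most [n], each colored by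
    itself, so the operation computes the color; the proof splits off the
    smallest prime factor repeatedly. *)
Lemma mult_coloring_unique n (op : color n -> color n -> color n)
    (c c' : elt (K n) -> color n) : 0 < n ->
  (forall i, c (of_color (K n) i) = i) ->
  (forall i, c' (of_color (K n) i) = i) ->
  (forall a b, c (Defs.mul a b) = op (c a) (c b)) ->
  (forall a b, c' (Defs.mul a b) = op (c' a) (c' b)) ->
  c = c'.
Proof.
move=> n_gt0 c_col c'_col c_op c'_op; apply/funext => -[m mK].
have agree k (k_gt0 : 0 < k) (le_kn : k <= n) (x : elt (K n)) :
    val x = k -> c x = c' x.
  move=> xk; pose i : color n :=
    exist (fun i : 'I_n.+1 => 0 < i) (Ordinal (le_kn : k < n.+1)) k_gt0.
  have -> : x = of_color (K n) i by exact: val_inj.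
  by rewrite c_col c'_col.
elim/ltn_ind: m mK => m ih mK.
have m_gt0 := K_pred_gt0 mK.
have [m_le1|m_gt1] := leqP m 1.
  by apply: (agree 1) => //=; apply/eqP; rewrite eqn_leq m_le1.
have p_prime := pdiv_prime m_gt1; have p_dvd := pdiv_dvd m.
have mE : pdiv m * (m %/ pdiv m) = m by rewrite mulnC divnK.
have p_le : pdiv m <= n.
  by case/andP: mK => _ /allP/(_ (pdiv m)); apply; rewrite pi_pdiv.
have pK : K_pred n (pdiv m) by rewrite /K_pred pnatE.
have dK : K_pred n (m %/ pdiv m).
  by apply: pnat_dvd mK; apply/dvdnP; exists (pdiv m).
pose P := dom_pred (K n).
have -> : exist P m mK = Defs.mul (exist P _ pK : elt (K n)) (exist P _ dK).
  by apply: val_inj; rewrite /= mE.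
rewrite c_op c'_op (agree (pdiv m) (pdiv_gt0 m)) // ih //.
by rewrite ltn_Pdiv // prime_gt1.
Qed.

Lemma finite_mult_satisfactory_K n : 0 < n ->
  finite_set (mult_satisfactory (K n)).
Proof.
move=> n_gt0.
pose one : color n :=
  exist (fun i : 'I_n.+1 => 0 < i) (Ordinal (n_gt0 : 1 < n.+1)) isT.
pose P (op : {ffun color n * color n -> color n}) : set (elt (K n) -> color n) :=
  [set c | (forall i, c (of_color (K n) i) = i) /\
           forall a b, c (Defs.mul a b) = op (c a, c b)].
(* Each law yields one coloring, chosen by [xget]; by uniqueness it is the only
   one for that law, so these choices exhaust the set. *)
apply: (@sub_finite_set _ _ (range (fun op => xget (fun=> one) (P op)))).
  move=> c [[c_col _] [op [_ c_op]]]; exists [ffun x => op x.1 x.2] => //.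
  have Pc : P [ffun x => op x.1 x.2] c by split=> // a b; rewrite ffunE.
  have [c'_col c'_op] := xgetPex (fun=> one) (ex_intro _ c Pc).
  apply: (@mult_coloring_unique n op) => // a b.
  by rewrite c'_op ffunE.
exact/finite_image/finite_finset.
Qed.

Theorem theorem1p8 (R : realType) :
  (forall n : nat, 1 < n ->
     ((exists c : elt (K n) -> color n, satisfactory c /\ multiplicative c) <->
      (mult_satisfactory (Zpos n) #= [set: R])%card)) /\
  (forall n : nat, 0 < n -> finite_set (mult_satisfactory (K n))).
Proof.
split=> [n n_gt1|n]; last exact: finite_mult_satisfactory_K.
have bool_real := card_bool_real R.
split=> [[c c_ms]|card_R].
  apply: card_eq_trans bool_real; rewrite card_eq_le.
  by rewrite card_le_fun_bool (card_le_mult_satisfactory n_gt1 c_ms).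
have [c c_ms] : mult_satisfactory (Zpos n) !=set0.
  apply/set0P/eqP => no; move: card_R; rewrite no card_eq_le => /andP[_].
  by move=> /card_le0P R0; have : [set: R] 0%R by []; rewrite R0.
by exists (c \o @K_Zpos n); exact: restrict_mult_satisfactory.
Qed.
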